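(* Let $X_1,X_2,\ldots$ be i.i.d. Poisson random variables with mean $\lambda\in(0,\infty)$. Let $\varepsilon>0$, $\delta\in(0,1)$, let $\delta_1,\delta_2,\ldots$ be positive numbers with $\sum_{\ell=1}^\infty\delta_\ell=\delta$, let $m_1<m_2<\cdots$ be an infinite sequence of positive integers with $\lim_{\ell\to\infty}\frac{\ln\delta_\ell}{m_\ell}=0$, and let $\mathcal N$ be a set of positive integers containing $\{m_1,m_2,\ldots\}$. Let $\overline{X}_n=\frac1n\sum_{i=1}^nX_i$. Let $\mathbf n$ be the smallest $n\in\mathcal N$ for which there exists a positive integer $\ell$ with $$M_{\mathrm P}\left(\overline{X}_n+\varepsilon-\frac{n\varepsilon}{n\vee m_\ell},\ \overline{X}_n+\varepsilon\right)\le\frac1{m_\ell}\ln\frac{\delta_\ell}{2}.$$ Then such an $n$ exists with probability $1$ (i.e. the sampling process eventually stops almost surely), and $\Pr\{|\overline{X}_{\mathbf n}-\lambda|<\varepsilon\}\ge1-\delta$.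
   Context: $a\vee b$ denotes $\max(a,b)$. The function $M_{\mathrm P}$ is defined by: $M_{\mathrm P}(z,\theta)=z-\theta+z\ln\frac{\theta}{z}$ for $z>0$, $\theta>0$; $M_{\mathrm P}(0,\theta)=-\theta$ for $\theta>0$; $M_{\mathrm P}(z,\theta)=-\infty$ for $z\ge0$, $\theta\le0$. *)

(* Defs.v *)
From HB Require Import structures.
From mathcomp Require Import all_boot all_order all_algebra finmap.
From mathcomp Require Import all_classical all_reals all_analysis.

Set Implicit Arguments.
Unset Strict Implicit.
Unset Printing Implicit Defensive.

Import Order.TTheory GRing.Theory Num.Theory.
Import numFieldNormedType.Exports.

Local Open Scope classical_set_scope.
Local Open Scope ring_scope.

Definition mutually_independent (d d' : measure_display)
    (T : measurableType d) (T' : measurableType d') (R : realType)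
    (P : probability T R) (X : nat -> {RV P >-> T'}) : Prop :=
  forall (J : {fset nat}) (B : nat -> set T'),
    (forall i, i \in J -> measurable (B i)) ->
    P (\bigcap_(i in [set` J]) (X i @^-1` B i))
      = (\prod_(i <- J) P (X i @^-1` B i))%E.

(* The second argument of poisson_prob is a dummy: its value does not occur in
   the body of the definition. *)
Definition iid_poisson (d : measure_display) (T : measurableType d)
    (R : realType) (P : probability T R) (X : nat -> {RV P >-> nat})
    (lambda : R) : Prop :=
  mutually_independent X /\
  forall i, distribution P (X i) = poisson_prob lambda 0%N :> (set nat -> \bar R).

(* Only meaningful for z >= 0. *)
Definition MP (R : realType) (z theta : R) : \bar R :=
  if theta <= 0 then -oo%E
  else if z == 0 then (- theta)%:E
  else (z - theta + z * ln (theta / z))%:E.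

Section SamplingScheme.
Context (d : measure_display) (T : measurableType d) (R : realType).
Context (P : probability T R).

(* Sequences are indexed from 0: X i, deltas l and m l are the (i+1)-th random
   variable, the (l+1)-th delta and the (l+1)-th m. *)
Implicit Types (X : nat -> {RV P >-> nat}) (deltas : nat -> R) (m : nat -> nat).
Implicit Types (NN : set nat) (eps : R) (n : nat) (w : T).

Definition sample_mean X n w : R := (\sum_(i < n) (X i w)%:R) / n%:R.

Definition stop_cond X eps deltas m n w : Prop :=
  exists l : nat,
    (MP (sample_mean X n w + eps - n%:R * eps / (maxn n (m l))%:R)
        (sample_mean X n w + eps)
     <= ((m l)%:R^-1 * ln (deltas l / 2))%:E)%E.

Definition is_sample_number X eps deltas m NN n w : Prop :=
  [/\ NN n, stop_cond X eps deltas m n w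
    & forall k, NN k -> stop_cond X eps deltas m k w -> (n <= k)%N].

End SamplingScheme.

(* Main.v *)
(* Write [y] for the sample mean of size [n], [r = n / max(n, m_l)] and
   [c = ln (delta_l / 2) / m_l].  Suppose the stopping rule fires at [n] through
   the index [l] with [|y - lambda| >= eps].  Two inequalities for the rate
   function [M], one for each side of [lambda], give
   [M (lambda + r (y - lambda)) lambda <= c].  With [t] solving
   [M (lambda e^t) lambda = c] on the corresponding side, this forces
   [t S_n - n lambda (e^t - 1) >= - m_l c = ln (2 / delta_l)], where [S_n] is
   the sum of the first [n] observations.  The exponential of the left-hand
   side is a nonnegative martingale of mean 1, so its maximal inequality bounds
   the probability that this ever happens by [delta_l / 2]; summing over both
   sides and all [l] gives [delta].  Termination follows from the same
   inequality with [t = 1], which bounds the sample mean of size [m_l] outside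
   an event of probability [e^(- m_l)].  The maximal inequality itself is proved
   without integration: tilting the Poisson weights of rate [lambda] by
   [e^(t x - lambda (e^t - 1))] gives those of rate [lambda e^t]. *)

Require Import Defs.
From HB Require Import structures.
From mathcomp Require Import all_boot all_order all_algebra finmap.
From mathcomp Require Import all_classical all_reals all_analysis.
From mathcomp Require Import ring lra.
Set Implicit Arguments.
Unset Strict Implicit.
Unset Printing Implicit Defensive.
Import Order.TTheory GRing.Theory Num.Theory.
Import numFieldNormedType.Exports.
Local Open Scope classical_set_scope.
Local Open Scope ring_scope.

(** * The Poisson rate function: duality, comparison, monotonicity *)

Section poisson_rate.
Context {R : realType}.
Implicit Types z theta lambda s t c y r : R.

(** At [z = 0] the product vanishes whatever the quotient is, so one formula covers both finite
    branches of [MP]. *)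
Definition rate z theta : R := z - theta + z * ln (theta / z).

Lemma MP_rate z theta : 0 < theta -> MP z theta = (rate z theta)%:E.
Proof.
move=> theta0; rewrite /MP leNgt theta0 /=; case: eqP => // ->.
by rewrite /rate mul0r addr0 sub0r.
Qed.

Lemma ln_le_subr1 (x : R) : 0 < x -> ln x <= x - 1.
Proof.
by move=> x0; have := @le_ln1Dx R (x - 1); rewrite (addrC 1) subrK; apply; lra.
Qed.

(* Legendre duality: the right-hand side is minimal at [s = ln (z / theta)],
   where it equals [rate z theta]. *)
Lemma rate_le_dual z theta s : 0 <= z -> 0 < theta ->
  rate z theta <= theta * (expR s - 1) - s * z.
Proof.
move=> z0 theta0; rewrite /rate.
have e0 := expR_gt0 s.
move: z0; rewrite le_eqVlt => /predU1P[<-|z0].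
  by rewrite mul0r mulr0; nra.
have -> : theta / z = expR (- s) * (theta * expR s / z).
  by rewrite -!mulrA [expR (- s) * _]mulrCA mulrA mulrA -[theta * _ * _]mulrA
     -expRD addNr expR0 mulr1 mulrC.
have w0 : 0 < theta * expR s / z by rewrite divr_gt0// mulr_gt0.
rewrite lnM ?posrE ?expR_gt0// expRK.
have := ler_wpM2l (ltW z0) (ln_le_subr1 w0).
rewrite mulrBr mulrCA mulfV ?gt_eqF//; nra.
Qed.

Lemma rate_expR theta t : 0 < theta ->
  rate (theta * expR t) theta = theta * (expR t - 1) - t * (theta * expR t).
Proof.
move=> theta0; rewrite /rate.
have -> : theta / (theta * expR t) = expR (- t).
  by rewrite invfM mulrA divff ?gt_eqF// mul1r expRN.
by rewrite expRK; ring.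
Qed.

Lemma rate_dual_eq z theta : 0 < z -> 0 < theta ->
  rate z theta = theta * (z / theta - 1) - ln (z / theta) * z.
Proof.
move=> z0 theta0; have zt0 : 0 < z / theta by rewrite divr_gt0.
have := rate_expR (ln (z / theta)) theta0.
by rewrite lnK ?posrE// [theta * (z / theta)]mulrC divfK ?gt_eqF.
Qed.

Lemma rate_refl theta : 0 < theta -> rate theta theta = 0.
Proof. by move=> t0; rewrite /rate divff ?gt_eqF// ln1 mulr0 subrr addr0. Qed.

Lemma rate_expR_lt0 theta t : 0 < theta -> t != 0 ->
  rate (theta * expR t) theta < 0.
Proof.
move=> theta0 t0; rewrite rate_expR//.
have e0 := expR_gt0 t.
have : 1 - t < expR (- t) by apply: expR_gt1Dx; rewrite oppr_eq0.
rewrite -(ltr_pM2l e0) -expRD subrr expR0 => h.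
by nra.
Qed.

(** Using on the left the dual parameter [ln v] that is optimal on the right leaves [lambda - theta]
    times [v - 1 - (1 - r) * ln v]. The latter is nonpositive because [1 - r <= v <= 1] and
    [v * (1 - ln v) <= 1]. *)
Lemma rate_lower_dom y r theta lambda : 0 <= y -> 0 <= r <= 1 ->
  0 < theta -> y <= theta -> theta <= lambda ->
  rate (lambda + r * (y - lambda)) lambda <= rate (theta + r * (y - theta)) theta.
Proof.
move=> y0 /andP[r0 r1] theta0 ytheta thetalambda.
have lambda0 : 0 < lambda by exact: lt_le_trans thetalambda.
have z'0 : 0 <= lambda + r * (y - lambda) by nra.
have : 0 <= theta + r * (y - theta) by nra.
(* A convex combination of [y >= 0] and [theta > 0] vanishes only for [r = 1] and [y = 0]; the claim
   is then [- lambda <= - theta]. *)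
rewrite le_eqVlt => /predU1P[/esym z0|z0].
  have r1' : r = 1.
    apply/eqP; rewrite eq_le r1 leNgt; apply/negP => rlt1.
    have : 0 < (1 - r) * theta by rewrite mulr_gt0// subr_gt0.
    by nra.
  have y0' : y = 0 by move: z0; rewrite r1'; lra.
  by rewrite r1' y0' !mul1r !sub0r !subrr /rate !mul0r; lra.
set z := theta + _ in z0 *; set z' := lambda + _ in z'0 *.
set v := z / theta.
have v0 : 0 < v by rewrite divr_gt0.
have vE : v * theta = z by rewrite divfK// gt_eqF.
have ev : expR (ln v) = v by rewrite lnK.
apply: (le_trans (rate_le_dual (ln v) z'0 lambda0)).
rewrite rate_dual_eq// -/v ev.
have v1 : v <= 1 by rewrite ler_pdivrMr// mul1r /z; nra.
have s0 : ln v <= 0 by rewrite ln_le0.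
have rv : 1 - r <= v by rewrite ler_pdivlMr// /z; nra.
have h : v * (1 - ln v) <= 1.
  have := @expR_ge1Dx R (- ln v).
  rewrite -(ler_pM2l v0) expRN ev divff ?gt_eqF//.
have h2 : v - 1 - (1 - r) * ln v <= 0 by nra.
have : (lambda - theta) * (v - 1 - (1 - r) * ln v) <= 0 by nra.
rewrite /z' /z; nra.
Qed.

(** The derivative is [(expR x - 1) ^+ 2]. At [x = ln u] this compares [ln u] with its second-order
    Taylor polynomial at 1. *)
Lemma ln_quad_mono : {homo (fun x : R => x - expR x + (expR x - 1) ^+ 2 / 2)
  : x y / x <= y}.
Proof.
set f := fun x : R => _.
have df (x : R) : is_derive x 1 f ((expR x - 1) ^+ 2).
  rewrite /f; apply: is_derive_eq.
  by rewrite /GRing.scale /=; field.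
have f_derivable (x : R) : derivable f x 1 by have [] := df x.
have f_cont : continuous f.
  by move=> x; apply: differentiable_continuous; apply/derivable1_diffP.
move=> x y xy.
apply: (@ger0_derive1_ndecr R f x y) => //.
- by move=> u _; rewrite derive1E; have [_ ->] := df u; rewrite sqr_ge0.
- exact: continuous_subspaceT.
Qed.

Lemma ln_ge_quad (u : R) : 1 <= u -> (u - 1) - (u - 1) ^+ 2 / 2 <= ln u.
Proof.
move=> u1; have u0 : 0 < u by lra.
have := ln_quad_mono (ln_ge0 u1).
by rewrite lnK// expR0; lra.
Qed.

Lemma ln_le_quad (u : R) : 0 < u <= 1 -> ln u <= (u - 1) - (u - 1) ^+ 2 / 2.
Proof.
move=> /andP[u0 u1].
have := ln_quad_mono (ln_le0 u1).
by rewrite lnK// expR0; lra.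
Qed.

Lemma rate_ge_quad z theta : 0 < z -> z <= theta ->
  - ((theta - z) ^+ 2 / (2 * z)) <= rate z theta.
Proof.
move=> z0 ztheta.
have := @ln_ge_quad (theta / z); rewrite ler_pdivlMr// mul1r => /(_ ztheta).
move=> /(ler_wpM2l (ltW z0)); rewrite /rate => h.
rewrite -lerBlDl (le_trans _ h)// le_eqVlt; apply/orP; left; apply/eqP.
by field; lra.
Qed.

Lemma rate_le_quad z theta : 0 < theta -> theta <= z ->
  rate z theta <= - ((theta - z) ^+ 2 / (2 * z)).
Proof.
move=> theta0 ztheta; have z0 : 0 < z by lra.
have := @ln_le_quad (theta / z).
rewrite ler_pdivrMr// mul1r ztheta divr_gt0// => /(_ isT).
move=> /(ler_wpM2l (ltW z0)); rewrite /rate => h.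
rewrite -lerBrDl (le_trans h)// le_eqVlt; apply/orP; left; apply/eqP.
by field; lra.
Qed.

(* Both sides are compared with quadratic bounds, whose denominators are
   ordered because [lambda + r * (y - lambda) <= y <= y + (1 - r) * eps]. *)
Lemma rate_upper_dom y r eps lambda : 0 < eps -> 0 <= r <= 1 -> 0 < lambda ->
  lambda + eps <= y ->
  rate (lambda + r * (y - lambda)) lambda
    <= rate (y + eps - r * eps) (y + eps).
Proof.
move=> eps0 /andP[r0 r1] lambda0 ley.
apply: (@le_trans _ _ (- ((lambda - (lambda + r * (y - lambda))) ^+ 2
    / (2 * (lambda + r * (y - lambda)))))).
  by apply: rate_le_quad => //; nra.
apply: le_trans; last by apply: rate_ge_quad; nra.
rewrite lerN2 ler_pM ?sqr_ge0 ?invr_ge0//; [nra| |].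
- have -> : y + eps - (y + eps - r * eps) = r * eps by ring.
  have -> : lambda - (lambda + r * (y - lambda)) = - (r * (y - lambda)) by ring.
  by rewrite sqrrN; apply: lerXn2r; rewrite ?nnegrE; nra.
- by rewrite lef_pV2 ?posrE; nra.
Qed.

(** The rate decreases away from [lambda] on either side. The dual bound at [s = ln (z / lambda)]
    gives [s * (lambda * expR t - z) <= 0], and [s] has the sign of [t]. *)
Lemma rate_threshold z lambda t : 0 < lambda -> 0 <= z -> t != 0 ->
  0 <= t * (z - lambda) ->
  rate z lambda <= rate (lambda * expR t) lambda ->
  t * (lambda * expR t) <= t * z.
Proof.
move=> lambda0 z0 t0 tz le_rate; rewrite leNgt; apply/negP => lt_tz.
have e0 := expR_gt0 t.
have zpos : 0 < z.
  rewrite lt_neqAle z0 andbT; apply/eqP => z00.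
  by move: tz lt_tz; rewrite -z00; nra.
have zneq : z != lambda.
  apply: contraTneq le_rate => ->.
  by rewrite rate_refl// -ltNge rate_expR_lt0.
set s := ln (z / lambda).
have := rate_le_dual s (ltW (mulr_gt0 lambda0 e0)) lambda0.
rewrite lnK ?posrE ?divr_gt0//.
move: le_rate; rewrite (rate_dual_eq zpos lambda0) -/s => le_rate h.
have hs : s * (lambda * expR t - z) <= 0 by nra.
have [tlt|tgt] : t < 0 \/ 0 < t by move: t0; rewrite neq_lt => /orP.
- have s0 : s < 0.
    by apply: ln_lt0; rewrite divr_gt0//= ltr_pdivrMr// mul1r lt_neqAle zneq; nra.
  by nra.
- have s0 : 0 < s.
    by apply: ln_gt0; rewrite ltr_pdivlMr// mul1r lt_neqAle eq_sym zneq; nra.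
  by nra.
Qed.

(** Intermediate value theorem in [t] between 0, where the rate vanishes, and [ln (z / lambda)],
    where it is at most [c]; [c < 0] excludes [t = 0]. *)
Lemma rate_solve z lambda c : 0 < lambda -> 0 < z -> rate z lambda <= c ->
  c < 0 ->
  exists t, [/\ t != 0, 0 < t * (z - lambda)
    & rate (lambda * expR t) lambda = c].
Proof.
move=> lambda0 z0 zc c0.
pose f t := lambda * (expR t - 1) - t * (lambda * expR t).
have f_cont : continuous f.
  move=> x; apply: cvgB.
    apply: cvgM; first exact: cvg_cst.
    by apply: cvgB; [exact: continuous_expR|exact: cvg_cst].
  apply: cvgM; first exact: cvg_id.
  by apply: cvgM; [exact: cvg_cst|exact: continuous_expR].
have f0 : f 0 = 0 by rewrite /f expR0; ring.
set s := ln (z / lambda).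
have zl0 : 0 < z / lambda by rewrite divr_gt0.
have es : expR s = z / lambda by rewrite lnK.
have fs : f s = rate z lambda.
  by rewrite rate_dual_eq// /f es [lambda * (z / lambda)]mulrC divfK ?gt_eqF.
have fE t : f t = rate (lambda * expR t) lambda by rewrite rate_expR.
have zneq : z != lambda.
  by apply: contraTneq zc => ->; rewrite rate_refl// -ltNge.
have [zlt|zgt] : z < lambda \/ lambda < z by move: zneq; rewrite neq_lt => /orP.
- have s0 : s <= 0 by apply: ln_le0; rewrite ler_pdivrMr// mul1r ltW.
  have [|t] := IVT s0 (continuous_subspaceT f_cont) (v := c).
    by rewrite f0 fs ge_min le_max zc (ltW c0) ?orbT.
  rewrite in_itv/= => /andP[_ t0] ft.
  have tn0 : t != 0 by apply/eqP => t00; move: c0; rewrite -ft t00 f0 ltxx.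
  have tlt0 : t < 0 by rewrite lt_neqAle tn0.
  by exists t; split; rewrite -?fE//; nra.
- have s0 : 0 <= s by apply: ln_ge0; rewrite ler_pdivlMr// mul1r ltW.
  have [|t] := IVT s0 (continuous_subspaceT f_cont) (v := c).
    by rewrite f0 fs ge_min le_max zc (ltW c0) ?orbT.
  rewrite in_itv/= => /andP[t0 _] ft.
  have tn0 : t != 0 by apply/eqP => t00; move: c0; rewrite -ft t00 f0 ltxx.
  have tlt0 : 0 < t by rewrite lt_neqAle eq_sym tn0.
  by exists t; split; rewrite -?fE//; nra.
Qed.

(** Here [q] stands for [max(n, m)], and [q * (z - lambda) = S - n * lambda]. Since
    [expR t - 1 - t >= 0], replacing [n] by [q] gives the lower bound [- (q * c)], and [c <= 0]
    allows passing to [m]. *)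
Lemma tilted_walk_ge lambda t c (n m q S : R) :
  0 < lambda -> 0 < n -> n <= q -> m <= q ->
  c = rate (lambda * expR t) lambda -> c <= 0 ->
  t * (lambda * expR t) <= t * (lambda + n / q * (S / n - lambda)) ->
  - (m * c) <= t * S - n * (lambda * (expR t - 1)).
Proof.
move=> lambda0 n0 nq mq cE c0; set z := lambda + _ => tz.
have q0 : 0 < q by exact: lt_le_trans nq.
have qz : q * (z - lambda) = S - n * lambda.
  by rewrite /z; field; rewrite !gt_eqF.
move: cE; rewrite rate_expR// => cE.
have e1 := @expR_ge1Dx R t.
have h1 : q * (t * (lambda * expR t)) <= q * (t * z) by rewrite ler_pM2l.
have h2 : n * (lambda * (expR t - 1 - t)) <= q * (lambda * (expR t - 1 - t)).
  by apply: ler_wpM2r => //; rewrite mulr_ge0 ?(ltW lambda0)//; lra.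
have h3 : t * (q * (z - lambda)) = t * (S - n * lambda) by rewrite qz.
have h4 : q * c <= m * c by rewrite ler_wnM2r.
rewrite cE in h4 *.
by nra.
Qed.

(** The dual bound at [ln v], [v = B / (B + eps)], is affine in [y] with slope [v - 1 - ln v >= 0]
    and exact at [y = B]. *)
Lemma rate_shift_le y B eps : 0 < eps -> 0 < B -> 0 <= y <= B ->
  rate y (y + eps) <= rate B (B + eps).
Proof.
move=> eps0 B0 /andP[y0 yB].
have Beps0 : 0 < B + eps by lra.
have v0 : 0 < B / (B + eps) by rewrite divr_gt0.
apply: (le_trans (rate_le_dual (ln (B / (B + eps))) y0 _)); first lra.
rewrite (rate_dual_eq B0 Beps0).
have := @expR_ge1Dx R (ln (B / (B + eps))); rewrite lnK ?posrE// => h.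
set v := B / _ in h *; set s := ln _ in h *; nra.
Qed.

Lemma rate_shift_lt0 B eps : 0 < eps -> 0 < B -> rate B (B + eps) < 0.
Proof.
move=> eps0 B0; have Beps0 : 0 < B + eps by lra.
have v0 : 0 < B / (B + eps) by rewrite divr_gt0.
have v1 : B / (B + eps) < 1 by rewrite ltr_pdivrMr//; lra.
have BE : (B + eps) * expR (ln (B / (B + eps))) = B.
  by rewrite lnK// mulrC divfK ?gt_eqF.
by rewrite -[X in rate X]BE rate_expR_lt0// ln_eq0// lt_eqF.
Qed.

End poisson_rate.

(** * The Poisson random walk: maximal inequality and deviation bound *)

Section poisson_walk.
Context (d : measure_display) (T : measurableType d) (R : realType).
Context (P : probability T R) (X : nat -> {RV P >-> nat}) (lambda : R).
Hypothesis lambda_gt0 : 0 < lambda.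
Hypothesis X_iid : iid_poisson X lambda.
Implicit Types (t b : R) (x : nat -> nat) (k n N : nat) (w : T).

Definition psum n w : nat := (\sum_(i < n) X i w)%N.

Lemma measurable_psum n : measurable_fun setT (psum n).
Proof.
elim: n => [|n IH].
  rewrite (_ : psum 0 = cst 0%N); first exact: measurable_cst.
  by apply/funext => w; rewrite /psum big_ord0.
rewrite (_ : psum n.+1 = fun w => (psum n w + X n w)%N).
  by apply: measurable_realfun.measurable_fun_addn.
by apply/funext => w; rewrite /psum big_ord_recr.
Qed.

Lemma measurable_psum_pred n (Q : set nat) : measurable [set w | Q (psum n w)].
Proof.
rewrite (_ : [set w | _] = setT `&` psum n @^-1` Q); last by rewrite setTI.
exact: measurable_psum.
Qed.

Lemma measurable_ex_psum (Q : nat -> set nat) :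
  measurable [set w | exists n, Q n (psum n w)].
Proof.
rewrite (_ : [set w | _] = \bigcup_n [set w | Q n (psum n w)]).
  by apply: bigcupT_measurable => n; exact: measurable_psum_pred.
by apply/seteqP; split => w /= [n]; [exists n|move=> _; exists n].
Qed.

Definition cylinder k x : set T := [set w | forall i, (i < k)%N -> X i w = x i].

Lemma poisson_prob1 a : poisson_prob lambda 0 [set a] = (poisson_pmf lambda a)%:E.
Proof.
by rewrite /poisson_prob lambda_gt0 esum_set1// lee_fin poisson_pmf_ge0.
Qed.

Lemma cylinderE k x : cylinder k x =
  \bigcap_(i in [set` [fset i in iota 0 k]%fset]) (X i @^-1` [set x i]).
Proof.
apply/seteqP; split => w /= h i.
  by move=> /=; rewrite !inE /= mem_iota add0n => /h.
by move=> ik; apply: h; rewrite /= !inE /= mem_iota.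
Qed.

Lemma measurable_cylinder k x : measurable (cylinder k x).
Proof.
rewrite cylinderE; apply: bigcap_measurableType => i _.
by rewrite -[_ @^-1` _]setTI; exact: measurable_funP.
Qed.

Lemma cylinder_prob k x :
  P (cylinder k x) = (\prod_(i < k) poisson_pmf lambda (x i))%:E.
Proof.
have [indep dist] := X_iid.
rewrite cylinderE indep//.
rewrite (perm_big (iota 0 k)) /=; last first.
  apply: uniq_perm; rewrite ?fset_uniq ?iota_uniq// => i.
  by rewrite !inE.
rewrite -(big_mkord xpredT (fun i => poisson_pmf lambda (x i))) /index_iota subn0.
rewrite -prodEFin; apply: eq_bigr => i _.
by rewrite -poisson_prob1 -(dist i).
Qed.

Lemma poisson_pmf_tilt t a : poisson_pmf lambda a
    * expR (t * a%:R - lambda * (expR t - 1)) = poisson_pmf (lambda * expR t) a.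
Proof.
rewrite /poisson_pmf lambda_gt0 mulr_gt0 ?expR_gt0//.
rewrite exprMn -expRM_natr.
have -> : t * a%:R - lambda * (expR t - 1)
  = t * a%:R + lambda + - (lambda * expR t) by ring.
rewrite !expRD !expRN; field.
by rewrite !gt_eqF ?expR_gt0// ltr0n fact_gt0.
Qed.

Lemma poisson_pmf_sum (mu : R) : 0 < mu ->
  (\sum_(0 <= a <oo) (poisson_pmf mu a)%:E = 1)%E.
Proof.
move=> mu0; rewrite nneseries_esumT; last first.
  by move=> a; rewrite lee_fin poisson_pmf_ge0.
have : poisson_prob mu 0 [set: nat] = 1%E by exact: probability_setT.
by rewrite /poisson_prob mu0.
Qed.

(** Logarithm of the exponential martingale: the subtracted term is the cumulant generating function
    at [t] of a sum of [n] observations. *)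
Definition tilted t n (S : nat) : R := t * S%:R - n%:R * (lambda * (expR t - 1)).

(* On a cylinder the tilted walk starts from a known value; decomposing over
   the next observation is the induction step on the horizon [N]. *)
Lemma maximal_cylinder t b N k x :
  (P (cylinder k x `&`
      [set w | exists n, (k <= n <= k + N)%N /\ (b <= tilted t n (psum n w))%R])
   <= (\prod_(i < k) poisson_pmf lambda (x i)
       * expR (tilted t k (\sum_(i < k) x i)%N - b))%:E)%E.
Proof.
have mE k' N' : measurable [set w | exists n, (k' <= n <= k' + N')%N /\
    (b <= tilted t n (psum n w))%R].
  exact: (measurable_ex_psum (fun n S => (k' <= n <= k' + N')%N /\
    (b <= tilted t n S)%R)).
have psumE k' x' w : cylinder k' x' w -> psum k' w = (\sum_(i < k') x' i)%N.
  by move=> h; apply: eq_bigr => i _; exact: h.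
have pge0 k' x' : 0 <= \prod_(i < k') poisson_pmf lambda (x' i).
  by apply: prodr_ge0 => i _; exact: poisson_pmf_ge0.
(* Once the level is reached at time [k'], the exponential factor is at least 1 and the bound is
   trivial. *)
have crossed k' x' N' : b <= tilted t k' (\sum_(i < k') x' i)%N ->
    (P (cylinder k' x' `&` [set w | exists n, (k' <= n <= k' + N')%N /\
        (b <= tilted t n (psum n w))%R])
     <= (\prod_(i < k') poisson_pmf lambda (x' i)
         * expR (tilted t k' (\sum_(i < k') x' i)%N - b))%:E)%E.
  move=> bk; apply: (@le_trans _ _ (P (cylinder k' x'))).
    by apply: le_measure; rewrite ?inE//; [apply: measurableI|];
      try exact: measurable_cylinder.
  rewrite cylinder_prob lee_fin ler_peMr//.
  by rewrite -expR0 ler_expR subr_ge0.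
elim: N k x => [|N IH] k x;
    have [/crossed//|kb] := leP b (tilted t k (\sum_(i < k) x i)%N).
  rewrite (_ : _ `&` _ = set0) ?measure0 ?lee_fin ?mulr_ge0 ?expR_ge0//.
  apply/seteqP; split => // w [/psumE cw /= [n]].
  rewrite addn0 -eqn_leq => -[/eqP <-]; rewrite cw.
  by rewrite leNgt kb.
(* The events [F a] split by the value [a] of observation [k]. The level is not reached at time [k],
   so a crossing occurs from [k.+1] on and the horizon shrinks by one. *)
pose upd a i := if (i < k)%N then x i else a.
pose F a := cylinder k.+1 (upd a) `&` [set w | exists n,
  (k.+1 <= n <= k.+1 + N)%N /\ (b <= tilted t n (psum n w))%R].
apply: (@le_trans _ _ (\sum_(0 <= a <oo) P (F a))%E).
  apply: measure_sigma_subadditive.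
  - by move=> a; apply: measurableI => //; exact: measurable_cylinder.
  - by apply: measurableI => //; exact: measurable_cylinder.
  move=> w [cw [n [/andP[kn nk] bn]]]; exists (X k w) => //; split.
    move=> i; rewrite ltnS leq_eqVlt /upd => /predU1P[->|ik].
      by rewrite ltnn.
    by rewrite ik cw.
  exists n; split => //; rewrite addSnnS nk andbT ltn_neqAle kn andbT.
  apply/eqP => nk'; move: bn; rewrite -nk' (psumE _ _ _ cw) leNgt.
  by rewrite kb.
pose C := \prod_(i < k) poisson_pmf lambda (x i)
  * expR (tilted t k (\sum_(i < k) x i)%N - b).
apply: (@le_trans _ _
    (\sum_(0 <= a <oo) (C%:E * (poisson_pmf (lambda * expR t) a)%:E))%E).
  apply: lee_nneseries => [a _ _|a _]; first exact: measure_ge0.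
  apply: (le_trans (IH k.+1 (upd a))).
  rewrite -EFinM lee_fin -poisson_pmf_tilt !big_ord_recr/= /upd ltnn.
  have -> : \prod_(i < k) poisson_pmf lambda (if (i < k)%N then x i else a)
      = \prod_(i < k) poisson_pmf lambda (x i).
    by apply: eq_bigr => i _; rewrite ltn_ord.
  have -> : (\sum_(i < k) (if (i < k)%N then x i else a) = \sum_(i < k) x i)%N.
    by apply: eq_bigr => i _; rewrite ltn_ord.
  rewrite /C -!mulrA ler_wpM2l// mulrCA ler_wpM2l ?poisson_pmf_ge0//.
  rewrite -expRD ler_expR /tilted natrD -natr1.
  by rewrite le_eqVlt; apply/orP; left; apply/eqP; ring.
(* The tilted weights form a Poisson law and sum to 1: this is the martingale property. *)
rewrite nneseriesZl/=; last by move=> a _; rewrite lee_fin poisson_pmf_ge0.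
by rewrite poisson_pmf_sum ?mulr_gt0 ?expR_gt0// mule1.
Qed.

(** The bound on the empty cylinder is the same for every horizon, so continuity from below removes
    the horizon. *)
Lemma maximal_inequality t b :
  (P [set w | exists n, (b <= tilted t n (psum n w))%R] <= (expR (- b))%:E)%E.
Proof.
pose F N := [set w | exists n, (n <= N)%N /\ (b <= tilted t n (psum n w))%R].
have -> : [set w | exists n, (b <= tilted t n (psum n w))%R] = \bigcup_N F N.
  apply/seteqP; split => w /=; first by move=> [n bn]; exists n => //; exists n.
  by move=> [N _ [n [_ bn]]]; exists n.
have mF N : measurable (F N).
  exact: (measurable_ex_psum (fun n S => (n <= N)%N /\ (b <= tilted t n S)%R)).
have ndF : {homo F : n m / (n <= m)%N >-> (n <= m)%O}.
  move=> n m nm; apply/subsetPset => w [k [kn bk]]; exists k; split => //.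
  exact: leq_trans nm.
have cvgF := nondecreasing_cvg_mu (mu := P) mF (bigcupT_measurable _ mF) ndF.
rewrite -(cvg_lim _ cvgF)//; apply: lime_le.
  by apply/cvg_ex; eexists; exact: cvgF.
near=> N => /=.
have := maximal_cylinder t b N 0 (fun=> 0%N).
rewrite (_ : cylinder 0 _ = setT) ?setTI; last by apply/seteqP; split.
rewrite big_ord0 mul1r /tilted big_ord0 mulr0 mul0r subr0 sub0r; apply: le_trans.
apply: le_measure; rewrite ?inE//.
  exact: (measurable_ex_psum (fun n S => (0 <= n <= 0 + N)%N /\
    (b <= tilted t n S)%R)).
Unshelve. all: end_near.
Qed.

Lemma psum_eq0 k n w : (k <= n)%N -> psum n w = 0%N -> cylinder k (fun=> 0%N) w.
Proof.
move=> kn /eqP; rewrite /psum sum_nat_eq0 => /forallP /= h i ik.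
by have /eqP := h (Ordinal (leq_trans ik kn)).
Qed.

(* The tilt solving [rate (lambda * expR t) lambda = c] turns every outcome of
   [Q] into a crossing of the level [- m c].  Such a [t] is missing only if all
   outcomes have [lambda + r (S / n - lambda) = 0], i.e. a null sample of size
   at least [m]. *)
Lemma deviation_bound (Q : nat -> nat -> Prop) (m : nat) (c : R)
    (z := fun n S : nat =>
      lambda + n%:R / (maxn n m)%:R * (S%:R / n%:R - lambda)) :
  c < 0 -> (0 < m)%N ->
  (forall n S, Q n S -> (0 < n)%N /\ rate (z n S) lambda <= c) ->
  (forall n S, Q n S -> S%:R / n%:R <= lambda) \/
  (forall n S, Q n S -> lambda <= S%:R / n%:R) ->
  (P [set w | exists n, Q n (psum n w)] <= (expR (m%:R * c))%:E)%E.
Proof.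
move=> c0 m0 Qrate Qside.
have r01 n : (0 < n)%N -> 0 < (n%:R / (maxn n m)%:R : R) <= 1.
  move=> n0; have q0 : (0 < maxn n m)%N by rewrite leq_max n0.
  by rewrite divr_gt0 ?ltr0n//= ler_pdivrMr ?ltr0n// mul1r ler_nat leq_maxl.
have y0 n S : 0 <= S%:R / n%:R :> R by rewrite divr_ge0.
have z0 n S : (0 < n)%N -> 0 <= z n S.
  move=> /r01 /andP[r0 r1]; have := y0 n S; rewrite /z.
  move: r0 r1; set r := n%:R / _; set y := S%:R / _ => r0 r1 yn.
  rewrite (_ : lambda + _ = (1 - r) * lambda + r * y); last by ring.
  by apply: addr_ge0; apply: mulr_ge0 => //; rewrite ?subr_ge0// ltW.
have [[n0 [S0 [Q0 z0_gt0]]]|noz] :=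
    pselect (exists n S, Q n S /\ 0 < z n S); last first.
  have [[n1 [S1 Q1]]|noQ] := pselect (exists n S, Q n S); last first.
    rewrite (_ : [set w | _] = set0) ?measure0 ?lee_fin ?expR_ge0//.
    by apply/seteqP; split => // w [n Qn]; apply: noQ; exists n, (psum n w).
  have Qz n S : Q n S -> z n S = 0.
    move=> Qn; have [n0 _] := Qrate _ _ Qn.
    apply/eqP; rewrite eq_le z0// andbT leNgt; apply/negP => zn.
    by apply: noz; exists n, S.
  have lambdac : - lambda <= c.
    have [_] := Qrate _ _ Q1.
    by rewrite Qz// /rate mul0r addr0 sub0r.
  apply: (@le_trans _ _ (P (cylinder m (fun=> 0%N)))).
    apply: le_measure; rewrite ?inE//.
    - exact: measurable_ex_psum.
    - exact: measurable_cylinder.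
    move=> w [n Qn]; have [n0 _] := Qrate _ _ Qn.
    have /andP[r0 r1] := r01 _ n0.
    have yn := y0 n (psum n w).
    have := Qz _ _ Qn; rewrite /z => zn.
    have rE : n%:R / (maxn n m)%:R = 1 :> R.
      apply/eqP; rewrite eq_le r1 leNgt; apply/negP => rlt1.
      have : 0 < (1 - n%:R / (maxn n m)%:R) * lambda.
        by rewrite mulr_gt0// subr_gt0.
      by nra.
    apply: (@psum_eq0 m n).
      apply/negbNE; rewrite -ltnNge; apply/negP => nm.
      move: rE; rewrite (maxn_idPr (ltnW nm)) => /eqP.
      by rewrite lt_eqF// ltr_pdivrMr ?ltr0n// mul1r ltr_nat.
    apply/eqP; rewrite -(eqr_nat R) -[_ == _]orbF.
    have : (psum n w)%:R / n%:R == 0 :> R by apply/eqP; move: zn; rewrite rE; lra.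
    by rewrite mulf_eq0 invr_eq0 !pnatr_eq0 [n == _]gtn_eqF.
  (* The null sample has probability [e^(- m lambda)], at most [e^(m c)] since [- lambda <= c]. *)
  rewrite cylinder_prob prodr_const card_ord lee_fin.
  rewrite /poisson_pmf lambda_gt0 expr0 fact0 invr1 !mul1r -expRM_natl ler_expR.
  by rewrite ler_wpM2l.
have [n0_gt0 rate0] := Qrate _ _ Q0.
(* One outcome supplies [t] for all: its equation involves only [c], and its sign only the side of
   [lambda], which all outcomes share. *)
have [t [tn0 tz0 ct]] := rate_solve lambda_gt0 z0_gt0 rate0 c0.
have := maximal_inequality t (- (m%:R * c)); rewrite opprK; apply: le_trans.
apply: le_measure; rewrite ?inE//.
- exact: measurable_ex_psum.
- exact: (measurable_ex_psum (fun n S => - (m%:R * c) <= tilted t n S)).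
move=> w [n Qn]; exists n.
have [n_gt0 raten] := Qrate _ _ Qn.
apply: (@tilted_walk_ge R lambda t c n%:R m%:R (maxn n m)%:R) => //.
- by rewrite ltr0n.
- by rewrite ler_nat leq_maxl.
- by rewrite ler_nat leq_maxr.
- exact: ltW.
apply: rate_threshold => //.
- exact: z0.
- have /andP[rn _] := r01 _ n_gt0; have /andP[r0 _] := r01 _ n0_gt0.
  move: tz0; rewrite /z !(addrC lambda) !addrK.
  set rn' := n%:R / _ in rn *; set r0' := n0%:R / _ in r0 *.
  case: Qside => side tz0; have := side _ _ Q0; have := side _ _ Qn.
  + rewrite -subr_le0 -(pmulr_rle0 _ rn) => zn.
    rewrite -subr_le0 -(pmulr_rle0 _ r0) => z0'.
    apply: mulr_le0 => //; rewrite leNgt; apply/negP => tp.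
    by move: tz0; rewrite pmulr_rgt0// ltNge z0'.
  + rewrite -subr_ge0 -(pmulr_rge0 _ rn) => zn.
    rewrite -subr_ge0 -(pmulr_rge0 _ r0) => z0'.
    apply: mulr_ge0 => //; rewrite leNgt; apply/negP => tp.
    by move: tz0; rewrite nmulr_rgt0// ltNge z0'.
- by rewrite ct.
Qed.

Lemma sample_meanE n w : sample_mean X n w = (psum n w)%:R / n%:R.
Proof. by rewrite /sample_mean natr_sum. Qed.

End poisson_walk.

(** * The stopping rule: measurability, levels and error probabilities *)

Section stopping.
Context (d : measure_display) (T : measurableType d) (R : realType).
Context (P : probability T R) (X : nat -> {RV P >-> nat}).
Context (lambda eps delta : R) (deltas : nat -> R) (m : nat -> nat).
Context (NN : set nat).
Hypothesis lambda_gt0 : 0 < lambda.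
Hypothesis X_iid : iid_poisson X lambda.
Hypothesis eps_gt0 : 0 < eps.
Hypothesis delta_lt1 : delta < 1.
Hypothesis deltas_gt0 : forall l, 0 < deltas l.
Hypothesis deltas_sum : series deltas @ \oo --> delta.
Hypothesis m_gt0 : forall l, (0 < m l)%N.
Hypothesis m_incr : forall k l, (k < l)%N -> (m k < m l)%N.
Hypothesis m_delta : (ln (deltas l) / (m l)%:R) @[l --> \oo] --> (0 : R).
Hypothesis NN_gt0 : forall n, NN n -> (0 < n)%N.
Hypothesis m_NN : forall l, NN (m l).

Let stop_at l n (S : nat) : Prop :=
  rate (S%:R / n%:R + eps - n%:R * eps / (maxn n (m l))%:R) (S%:R / n%:R + eps)
    <= (m l)%:R^-1 * ln (deltas l / 2).

Lemma stop_condE n w : stop_cond X eps deltas m n w =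
  exists l, stop_at l n (psum X n w).
Proof.
rewrite /stop_cond /stop_at !sample_meanE.
have theta0 : 0 < (psum X n w)%:R / n%:R + eps by rewrite ltr_wpDl// divr_ge0.
by apply/propext; split => -[l h]; exists l; move: h; rewrite MP_rate// lee_fin.
Qed.

Lemma measurable_stop : measurable [set w | exists n, NN n /\
  stop_cond X eps deltas m n w].
Proof.
rewrite (_ : [set w | _] = [set w | exists n, NN n /\
    exists l, stop_at l n (psum X n w)]).
  exact: (measurable_ex_psum X (fun n S => NN n /\ exists l, stop_at l n S)).
by apply/seteqP; split => w /= [n]; rewrite ?stop_condE => h; exists n;
  rewrite ?stop_condE.
Qed.

Lemma measurable_sample_number : measurable [set w | exists n,
  is_sample_number X eps deltas m NN n w /\
  (`|sample_mean X n w - lambda| < eps)%R].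
Proof.
pose QA n (S : nat) := [/\ NN n, exists l, stop_at l n S &
  `|S%:R / n%:R - lambda| < eps].
(* Minimality of [n] is tested one competitor [k] at a time, as each test depends on the sum of size
   [k] alone. *)
pose QB n k (S : nat) := NN k -> (exists l, stop_at l k S) -> (n <= k)%N.
pose A n := [set w | QA n (psum X n w)].
pose B n k := [set w | QB n k (psum X k w)].
rewrite (_ : [set w | _] = \bigcup_n (A n `&` \bigcap_k B n k)).
  apply: bigcupT_measurable => n; apply: measurableI.
    exact: (measurable_psum_pred X n (QA n)).
  by apply: bigcapT_measurable => k; exact: (measurable_psum_pred X k (QB n k)).
apply/seteqP; split => w /=.
  move=> [n [[NNn]]]; rewrite stop_condE sample_meanE => sn nmin close.
  exists n => //; split => // k _ NNk sk.
  by apply: nmin => //; rewrite stop_condE.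
move=> [n _ [[NNn sn close] nmin]]; exists n; rewrite sample_meanE; split => //.
split => //; first by rewrite stop_condE.
by move=> k NNk; rewrite stop_condE => sk; exact: nmin sk.
Qed.

(** With [delta < 1] this keeps [deltas l / 2] below 1, so the levels are negative as
    [deviation_bound] requires. *)
Lemma deltas_le l : deltas l <= delta.
Proof.
have nd : nondecreasing_seq (series deltas).
  by apply/nondecreasing_seqP => n; rewrite seriesSr lerDl ltW.
have cv : cvgn (series deltas) by apply/cvg_ex; exists delta.
have := nondecreasing_cvgn_le nd cv l.+1; rewrite (cvg_lim _ deltas_sum)//.
apply: le_trans; rewrite seriesSr lerDr /series /= sumr_ge0// => i _.
exact: ltW.
Qed.

Lemma level_lt0 l : (m l)%:R^-1 * ln (deltas l / 2) < 0.
Proof.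
rewrite pmulr_rlt0 ?invr_gt0 ?ltr0n//; apply: ln_lt0.
rewrite divr_gt0//= ltr_pdivrMr// mul1r (le_lt_trans (deltas_le l))//.
by rewrite (lt_trans delta_lt1)// ltr1n.
Qed.

Lemma expR_level l : expR ((m l)%:R * ((m l)%:R^-1 * ln (deltas l / 2)))
  = deltas l / 2.
Proof.
by rewrite mulVKf ?lnK ?posrE ?divr_gt0// pnatr_eq0 -lt0n.
Qed.

Let lower_err l n (S : nat) : Prop :=
  [/\ (0 < n)%N, stop_at l n S & S%:R / n%:R + eps <= lambda].

Let upper_err l n (S : nat) : Prop :=
  [/\ (0 < n)%N, stop_at l n S & lambda + eps <= S%:R / n%:R].

Let ratio_itv l n : (0 < n)%N -> 0 <= (n%:R / (maxn n (m l))%:R : R) <= 1.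
Proof.
move=> n0; have q0 : (0 < maxn n (m l))%N by rewrite leq_max n0.
by rewrite divr_ge0//= ler_pdivrMr ?ltr0n// mul1r ler_nat leq_maxl.
Qed.

Lemma lower_err_prob l :
  (P [set w | exists n, lower_err l n (psum X n w)] <= (deltas l / 2)%:E)%E.
Proof.
rewrite -expR_level; apply: (deviation_bound lambda_gt0 X_iid (level_lt0 l)) => //.
- move=> n S [n0 sn low]; split => //; apply: le_trans sn.
  have eps0 := eps_gt0; have yn : 0 <= S%:R / n%:R :> R by rewrite divr_ge0.
  (* The form [theta + r * (y - theta)] of [rate_lower_dom], with [theta = y + eps]. *)
  have -> : S%:R / n%:R + eps - n%:R * eps / (maxn n (m l))%:R =
      S%:R / n%:R + eps + n%:R / (maxn n (m l))%:R *
        (S%:R / n%:R - (S%:R / n%:R + eps)) by ring.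
  by apply: (rate_lower_dom yn (ratio_itv l n0)) => //; lra.
- by left => n S [_ _]; have := eps_gt0; lra.
Qed.

Lemma upper_err_prob l :
  (P [set w | exists n, upper_err l n (psum X n w)] <= (deltas l / 2)%:E)%E.
Proof.
rewrite -expR_level; apply: (deviation_bound lambda_gt0 X_iid (level_lt0 l)) => //.
- move=> n S [n0 sn up]; split => //; apply: le_trans sn.
  rewrite [n%:R * eps / _]mulrAC.
  exact: (rate_upper_dom eps_gt0 (ratio_itv l n0) lambda_gt0 up).
- by right => n S [_ _]; have := eps_gt0; lra.
Qed.

(** * Almost sure termination and coverage probability *)

Lemma m_ge l : (l < m l)%N.
Proof.
elim: l => [|l IH]; first exact: m_gt0.
exact: leq_trans (m_incr (ltnSn l)).
Qed.

(** Index [l] tested at size [m l] has ratio 1, so the rule compares [rate y (y + eps)] with a level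
    tending to 0. For [y <= B] this rate is at most [- kappa < 0], so for large [l] not stopping
    forces [y >= B]. *)
Lemma stop_prob1 :
  P [set w | exists n, NN n /\ stop_cond X eps deltas m n w] = 1%E.
Proof.
set A := [set w | _].
have mA : measurable A by exact: measurable_stop.
suff PA0 : P (~` A) = 0%E by rewrite -[A]setCK probability_setC ?PA0 ?sube0//;
  exact: measurableC.
apply/eqP; rewrite eq_le measure_ge0 andbT.
(* Chosen so that a mean of at least [B] at size [m l] is a crossing of level [m l] by the walk
   tilted with [t = 1]. *)
pose B := lambda * (expR 1 - 1) + 1.
have e1 : 1 < expR 1 :> R by have := @expR_gt1Dx R 1 (oner_neq0 _); lra.
have B0 : 0 < B by rewrite /B ltr_wpDl// mulr_ge0 ?ltW//; lra.
set kappa := - rate B (B + eps).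
have kappa0 : 0 < kappa by rewrite oppr_gt0 rate_shift_lt0.
apply/lee_addgt0Pr => e e0; rewrite add0e.
have k20 : 0 < kappa / 2 by rewrite divr_gt0.
near \oo => l.
have ml0 : 0 < (m l)%:R :> R by rewrite ltr0n.
have ml : l.+1%:R <= (m l)%:R :> R by rewrite ler_nat m_ge.
have ln_small : - (kappa / 2) < ln (deltas l) / (m l)%:R.
  near: l; apply: (cvgr_gt _ m_delta); lra.
have inv_small : l.+1%:R^-1 < kappa / 2.
  near: l; exact: (near_infty_natSinv_lt (PosNum k20)).
have inv_small' : l.+1%:R^-1 < e.
  near: l; exact: (near_infty_natSinv_lt (PosNum e0)).
have inv_le : (m l)%:R^-1 <= l.+1%:R^-1 :> R by rewrite lef_pV2 ?posrE ?ltr0n.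
(* Half of [kappa] absorbs [ln (deltas l) / m l], the other half [ln 2 / m l]. *)
have level_ge : - kappa <= (m l)%:R^-1 * ln (deltas l / 2).
  rewrite ln_div ?posrE// mulrBr [_ * ln (deltas l)]mulrC.
  have ln2 : ln 2 <= 1 :> R by have := @ln_le_subr1 R 2; lra.
  have ln2_small : (m l)%:R^-1 * ln 2 <= kappa / 2.
    rewrite (le_trans _ (ltW inv_small))// (le_trans _ inv_le)//.
    by rewrite ler_piMr// invr_ge0 ltW.
  by apply: le_trans (lerB (ltW ln_small) ln2_small); lra.
apply: (@le_trans _ _ (expR (- (m l)%:R))%:E); last first.
  rewrite lee_fin (le_trans _ (ltW inv_small'))// (le_trans _ inv_le)//.
  rewrite expRN lef_pV2 ?posrE ?expR_gt0//.
  by have := @expR_ge1Dx R (m l)%:R; lra.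
apply: le_trans (maximal_inequality lambda_gt0 X_iid 1 (m l)%:R).
apply: le_measure; rewrite ?inE; first exact: measurableC.
  exact: (measurable_ex_psum X (fun n S => (m l)%:R <= tilted lambda 1 n S)).
move=> w nA; exists (m l); rewrite leNgt; apply/negP => small; apply: nA.
exists (m l); split => //; rewrite stop_condE; exists l.
rewrite /stop_at maxnn mulrAC divff ?gt_eqF// mul1r addrK.
apply: le_trans level_ge; rewrite opprK; apply: rate_shift_le => //.
rewrite divr_ge0//= ler_pdivrMr//.
move: small; rewrite /tilted /B mul1r; nra.
Unshelve. all: end_near.
Qed.

(** An outcome that stops has a least admissible size; if the mean there is off by at least [eps],
    the index that fired puts the outcome in [E l]. Countable subadditivity concludes, never
    stopping being a null event. *)
Lemma sample_number_prob : ((1 - delta)%:E <=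
   P [set w | exists n, is_sample_number X eps deltas m NN n w /\
                        (`|sample_mean X n w - lambda| < eps)%R])%E.
Proof.
set G := [set w | _].
have mG : measurable G by exact: measurable_sample_number.
rewrite -[G]setCK probability_setC; last exact: measurableC.
pose A := [set w | exists n, NN n /\ stop_cond X eps deltas m n w].
have mA : measurable A by exact: measurable_stop.
pose E l := [set w | exists n, lower_err l n (psum X n w)] `|`
            [set w | exists n, upper_err l n (psum X n w)].
have mE l : measurable (E l) by apply: measurableU; exact: measurable_ex_psum.
have PE l : (P (E l) <= (deltas l)%:E)%E.
  apply: (le_trans (measureU2 P _ _)); try exact: measurable_ex_psum.
  rewrite [in leRHS](splitr (deltas l)) EFinD.
  by apply: leeD; [exact: lower_err_prob|exact: upper_err_prob].
have sub : ~` G `<=` ~` A `|` \bigcup_l E l.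
  move=> w nG; have [[n0 [NN0 s0]]|nA] := pselect (A w); last by left.
  right.
  have exn : exists n, `[< NN n /\ stop_cond X eps deltas m n w >].
    by exists n0; apply/asboolP.
  case: (ex_minnP exn) => n /asboolP[NNn sn] nmin.
  have far : ~ `|sample_mean X n w - lambda| < eps.
    move=> close; apply: nG; exists n; split => //; split => // k NNk sk.
    by apply: nmin; apply/asboolP.
  move: (sn); rewrite stop_condE => -[l sl]; exists l => //.
  move: far => /negP; rewrite -leNgt sample_meanE ler_normr => /orP[far|far].
    by right; exists n; split; [exact: NN_gt0| |lra].
  by left; exists n; split; [exact: NN_gt0| |lra].
suff : (P (~` G) <= delta%:E)%E.
  move=> h; rewrite EFinB; apply: leeB => //.
apply: (@le_trans _ _ (P (~` A `|` \bigcup_l E l))).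
  apply: le_measure; rewrite ?inE//; first exact: measurableC.
  by apply: measurableU; [exact: measurableC|exact: bigcupT_measurable].
apply: (le_trans (measureU2 P _ _)); [exact: measurableC|exact: bigcupT_measurable|].
have PA0 : P (~` A) = 0%E by rewrite probability_setC// stop_prob1 subee.
rewrite /= PA0 add0e.
apply: (@le_trans _ _ (\sum_(0 <= l <oo) P (E l))%E).
  by apply: measure_sigma_subadditive => //; exact: bigcupT_measurable.
apply: (@le_trans _ _ (\sum_(0 <= l <oo) (deltas l)%:E)%E).
  by apply: lee_nneseries => // l _; exact: PE.
rewrite -(cvg_lim _ deltas_sum)// -EFin_lim; last by apply/cvg_ex; exists delta.
by rewrite le_eqVlt; apply/orP; left; apply/eqP; apply/congr_lim/funext => n/=;
  rewrite /series/= -sumEFin.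
Qed.

End stopping.

Theorem mainTheorem5 (d : measure_display) (T : measurableType d)
    (R : realType) (P : probability T R) (X : nat -> {RV P >-> nat})
    (lambda eps delta : R) (deltas : nat -> R) (m : nat -> nat) (NN : set nat)
    (lambda_gt0 : 0 < lambda)
    (X_iid : iid_poisson X lambda)
    (eps_gt0 : 0 < eps)
    (delta_gt0 : 0 < delta) (delta_lt1 : delta < 1)
    (deltas_gt0 : forall l, 0 < deltas l)
    (deltas_sum : series deltas @ \oo --> delta)
    (m_gt0 : forall l, (0 < m l)%N)
    (m_incr : forall k l, (k < l)%N -> (m k < m l)%N)
    (m_delta : (ln (deltas l) / (m l)%:R) @[l --> \oo] --> (0 : R))
    (NN_gt0 : forall n, NN n -> (0 < n)%N)
    (m_NN : forall l, NN (m l)) :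
  P [set w | exists n, NN n /\ stop_cond X eps deltas m n w] = 1%E /\
  ((1 - delta)%:E <=
   P [set w | exists n, is_sample_number X eps deltas m NN n w /\
                        (`|sample_mean X n w - lambda| < eps)%R])%E.
Proof.
split; first exact: (stop_prob1 lambda_gt0 X_iid eps_gt0 deltas_gt0 m_gt0
  m_incr m_delta m_NN).
exact: (sample_number_prob lambda_gt0 X_iid eps_gt0 delta_lt1 deltas_gt0
  deltas_sum m_gt0 m_incr m_delta NN_gt0 m_NN).
Qed.
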